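(* Let $2\le t\le q$ be integers, let $H$ be a linear $C^{q+1}_{1,t+1}$-free $(q+1)$-uniform hypergraph, and let $e=\{v_1,\dots,v_{q+1}\}$ be an edge of $H$. The following are equivalent: (1) $\delta_H(e)=0$; (2) every point of $e$ has degree $D=tq+1$ in $H$; (3) the petal trace at $e$ is a disjoint union of $t$ affine planes of order $q$, with the colors as parallel classes; that is, there are pairwise disjoint $q^2$-point sets $\Omega_1,\dots,\Omega_t$ and partitions $\mathcal F_i(e)=\mathcal F_i^1\sqcup\dots\sqcup\mathcal F_i^t$ $(1\le i\le q+1)$ such that for every $b\in\{1,\dots,t\}$ the set $\bigcup_{i=1}^{q+1}\mathcal F_i^b$ is the set of lines of an affine plane of order $q$ on the point set $\Omega_b$, whose $q+1$ parallel classes are $\mathcal F_1^b,\dots,\mathcal F_{q+1}^b$. Moreover, when these hold, for each affine packet $b$, adjoining the base point $v_i$ to every line of color $i$ (i.e. replacing each $A\in\mathcal F_i^b$ by $A\cup\{v_i\}$, for all $i$) and adjoining the base edge $e$ as a line produces a projective plane of order $q$ on the point set $\Omega_b\cup e$. The resulting $t$ projective planes have common line $e$ and are otherwise disjoint.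
   Context: A hypergraph $H$ is finite; it is $r$-uniform if every edge is an $r$-element set of vertices, and linear if any two distinct edges share at most one vertex. $d_H(v)$ is the number of edges containing $v$. For $3\le k\le r$ the crown $C^r_{1,k}$ consists of a base edge $e_0$ and pairwise disjoint edges (petals) $e_1,\dots,e_k$ with $e_0\cap e_i=\{v_i\}$, where $v_1,\dots,v_k$ are distinct points of $e_0$; $H$ is $C^r_{1,k}$-free if it contains no such configuration of edges. Here $r=q+1$, $k=t+1$, $D=tq+1$. For an edge $e$ define $\delta_H(e)=\sum_{v\in e}\frac1{d_H(v)}-\frac{r}{D}$. For an edge $e=\{v_1,\dots,v_r\}$ and $1\le i\le r$, the $i$-th petal family is $\mathcal F_i(e)=\{f\setminus\{v_i\}: f\in E(H)\setminus\{e\},\ v_i\in f\}$; the index $i$ is called a color, and the colored system $\mathcal F_1(e),\dots,\mathcal F_r(e)$ is the petal trace at $e$. *)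

(* Defs.v *)
From mathcomp Require Import all_boot all_order all_algebra.

Set Implicit Arguments.
Unset Strict Implicit.
Unset Printing Implicit Defensive.

Import GRing.Theory.

(* A finite hypergraph is given by its vertex type V : finType and its edge
   set E : {set {set V}}. *)

Section Hypergraph.
Variables (V : finType) (E : {set {set V}}).

Definition uniform_hypergraph (r : nat) : Prop :=
  forall f, f \in E -> #|f| = r.

Definition linear_hypergraph : Prop :=
  forall f g, f \in E -> g \in E -> f != g -> #|f :&: g| <= 1.

Definition deg (x : V) : nat := #|[set f in E | x \in f]|.

Definition is_crown (k : nat) (e0 : {set V}) (p : 'I_k -> {set V})
    (x : 'I_k -> V) : Prop :=
  [/\ e0 \in E,
      forall i, p i \in E,
      injective x,
      forall i, e0 :&: p i = [set x i]
    & forall i j, i != j -> [disjoint p i & p j]].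

(* The uniformity r of the crown is that of the ambient hypergraph. *)
Definition crown_free (k : nat) : Prop :=
  ~ exists e0 (p : 'I_k -> {set V}) (x : 'I_k -> V), is_crown e0 p x.

Definition delta (r D : nat) (e : {set V}) : rat :=
  (\sum_(x in e) (deg x)%:R^-1 - r%:R / D%:R)%R.

Definition petal_family (e : {set V}) (x : V) : {set {set V}} :=
  [set f :\ x | f in E :\ e & x \in f].

End Hypergraph.

Section Planes.
Variables (V : finType) (n : nat) (P : {set V}) (L : {set {set V}}).

Definition unique_joining_line : Prop :=
  forall x y, x \in P -> y \in P -> x != y ->
    exists! l, [/\ l \in L, x \in l & y \in l].

Definition affine_plane : Prop :=
  [/\ forall l, l \in L -> l \subset P /\ #|l| = n,
      unique_joining_line,
      forall x l, x \in P -> l \in L -> x \notin l ->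
        exists! m, [/\ m \in L, x \in m & [disjoint m & l]]
    & exists T : {set V}, [/\ T \subset P, #|T| = 3
        & forall l, l \in L -> ~~ (T \subset l)]].

Definition parallel (l m : {set V}) : bool := (l == m) || [disjoint l & m].

Definition parallel_classes : {set {set {set V}}} :=
  equivalence_partition parallel L.

Definition projective_plane : Prop :=
  [/\ forall l, l \in L -> l \subset P /\ #|l| = n.+1,
      unique_joining_line,
      forall l m, l \in L -> m \in L -> l != m ->
        exists! x, x \in l /\ x \in m
    & exists Q : {set V}, [/\ Q \subset P, #|Q| = 4
        & forall l, l \in L -> #|Q :&: l| <= 2]].

End Planes.

Section Packets.
Variables (V : finType) (E : {set {set V}}) (t q : nat).
Variables (e : {set V}) (v : 'I_q.+1 -> V).
Variables (Omega : 'I_t -> {set V}) (F : 'I_q.+1 -> 'I_t -> {set {set V}}).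

Definition packet_lines (b : 'I_t) : {set {set V}} := \bigcup_i F i b.

Definition affine_packets : Prop :=
  [/\ (forall b, #|Omega b| = q ^ 2) /\
        (forall b c, b != c -> [disjoint Omega b & Omega c]),
      forall i, petal_family E e (v i) = \bigcup_b F i b,
      forall i b c, b != c -> [disjoint F i b & F i c],
      forall b, affine_plane q (Omega b) (packet_lines b)
    & forall b, injective (F^~ b) /\
        parallel_classes (packet_lines b) = [set F i b | i : 'I_q.+1]].

Definition extended_lines (b : 'I_t) : {set {set V}} :=
  e |: \bigcup_i [set v i |: A | A in F i b].

End Packets.

(* Main.v *)
From mathcomp Require Import all_boot all_order all_algebra.
From mathcomp Require Import zify.
Require Import Defs.

Set Implicit Arguments.
Unset Strict Implicit.
Unset Printing Implicit Defensive.

(** Fix the edge e and look only at its petal trace: a point v_i of e is a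
    color, and the lines of color i are the sets f minus v_i for the edges
    f <> e through v_i.  Linearity makes lines of one color disjoint and lets
    lines of two colors share at most one point ([petal_system]); a crown with
    base e is exactly a rainbow matching, that is, a set of pairwise disjoint
    lines of different colors ([petal_rainbow_free]).

    Everything rests on one count.  If m disjoint lines are already chosen,
    they have m * q points, each on at most one line of a new color c; so color
    c still offers a line disjoint from them as soon as it has more than m * q
    lines ([rainbow_extend]).

    Since there is no rainbow matching of size t+1, some m <= t satisfies: at
    most t - m colors have more than m * q lines
    ([rainbow_free_few_large]).  For m < t the colors with few lines alone push
    the sum of the reciprocal degrees strictly above (q+1)/(tq+1); for m = t no
    degree exceeds tq+1, so the sum is at least (q+1)/(tq+1), with equality only
    if all degrees equal tq+1.  So delta vanishes at e exactly
    when all points of e have degree tq+1.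

    Suppose now that every color has exactly tq lines.  Every rainbow matching
    then extends to a transversal (a rainbow matching of size t) avoiding a
    prescribed color c.  The tq lines of color c must all meet its tq points,
    so each meets it exactly once and each of its points lies on a line of
    color c ([transversal_tight]).  Two consequences: all colors cover the same
    points ([line_through]), and a line meeting two lines of two further colors
    forces these two to meet, as otherwise they would belong to a common
    transversal ([meet_of_common_transversal]).  Hence, if a point x off a line
    B of color j is collinear with one point of B, the q lines through x of
    colors other than j all meet B, in different points, and so reach all q
    points of B.  Collinearity is therefore an equivalence relation
    ([collinear_trans]); its classes have 1 + (q+1)(q-1) = q^2 points, there
    are t of them as the tq lines of one color cover t q^2 points, and the
    same property of x and B is the parallel axiom in each class
    ([packet_affine]).  Conversely a parallel class of an affine plane of order
    q has q lines, which returns the degrees ([full_of_packets]).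

    In the projective completions every line is an edge of the linear
    hypergraph, so two points are on at most one line and two lines share at
    most one point; only existence has to be checked. *)

(** * Families of pairwise disjoint sets *)
Section DisjointFamilies.
Variable V : finType.
Implicit Types (D : {set {set V}}) (A B U : {set V}).

(** The pointwise form of triviality of intersections: it is applied directly
    to two members known to share a point. *)
Definition disjoint_family D : Prop :=
  forall A B x, A \in D -> B \in D -> x \in A -> x \in B -> A = B.

Lemma meetP A B :
  reflect (exists2 x, x \in A & x \in B) (~~ [disjoint A & B]).
Proof.
apply: (iffP pred0Pn) => [[x /andP[xA xB]] | [x xA xB]]; first by exists x.
by exists x; rewrite /= xA.
Qed.

Lemma disjoint_notin A B x : [disjoint A & B] -> x \in A -> x \in B -> False.
Proof. by move=> dAB xA xB; case/negP: (introT (meetP A B) (ex_intro2 _ _ x xA xB)). Qed.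

(** Double counting of the incidences between D and U: a point lies on at most
    one member of D. *)
Lemma sum_card_setI D U : disjoint_family D ->
  \sum_(A in D) #|A :&: U| = #|cover D :&: U|.
Proof.
move=> dD.
have cardI_sum A : #|A :&: U| = \sum_(x in U) (x \in A).
  rewrite -sum1_card big_mkcond [RHS]big_mkcond; apply: eq_bigr => x _.
  by rewrite inE; case: (x \in A); case: (x \in U).
rewrite cardI_sum; under eq_bigr do rewrite cardI_sum.
rewrite exchange_big; apply: eq_bigr => x _ /=.
case: (boolP (x \in cover D)) => [/bigcupP[A AD xA] | xND].
  rewrite (bigD1 A) //= xA big1 // => B /andP[BD neqBA].
  by apply/eqP; rewrite eqb0; apply: contra neqBA => xB; rewrite (dD _ _ _ BD AD xB xA).
rewrite big1 // => B BD; apply/eqP; rewrite eqb0; apply: contra xND => xB.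
by apply/bigcupP; exists B.
Qed.

Lemma leq_card_meeting D U : disjoint_family D ->
  (forall A, A \in D -> ~~ [disjoint A & U]) -> #|D| <= #|U|.
Proof.
move=> dD meetU; apply: (@leq_trans #|cover D :&: U|); last first.
  by rewrite subset_leq_card // subsetIr.
rewrite -sum_card_setI // -sum1_card; apply: leq_sum => A AD.
by rewrite card_gt0 setI_eq0 meetU.
Qed.

(** The equality case of [leq_card_meeting]: with at least as many members as
    there are points in U, no point of U can be wasted. *)
Lemma meeting_tight D U : disjoint_family D ->
    (forall A, A \in D -> ~~ [disjoint A & U]) -> #|U| <= #|D| ->
  (forall A, A \in D -> #|A :&: U| = 1) /\ U \subset cover D.
Proof.
move=> dD meetU leUD.
have ge1 A : A \in D -> 0 < #|A :&: U|.
  by move=> AD; rewrite card_gt0 setI_eq0 meetU.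
have leDU : #|D| <= #|cover D :&: U|.
  by rewrite -sum_card_setI // -sum1_card; apply: leq_sum.
have leIU : #|cover D :&: U| <= #|U| by rewrite subset_leq_card // subsetIr.
split=> [A AD|]; last first.
  by apply/setIidPr/eqP; rewrite eqEcard subsetIr (leq_trans leUD).
have := leq_trans leIU leUD; rewrite -sum_card_setI // -sum1_card.
rewrite (bigD1 A) //= [X in _ <= X](bigD1 A) //=.
have : \sum_(B in D | B != A) 1 <= \sum_(B in D | B != A) #|B :&: U|.
  by apply: leq_sum => B /andP[BD _]; apply: ge1.
move: (\sum_(B in D | B != A) 1) (\sum_(B in D | B != A) #|B :&: U|) (ge1 A AD).
lia.
Qed.

End DisjointFamilies.

(** * Rainbow matchings in colored systems *)
Section ColoredSystems.
Variables (I V : finType) (q : nat) (G : I -> {set {set V}}).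

(** The last clause says that lines of different colors share at most one
    point. *)
Definition colored_system : Prop :=
  [/\ forall i A, A \in G i -> #|A| = q,
      forall i, disjoint_family (G i)
    & forall i j A B x y, A \in G i -> B \in G j -> x \in A -> y \in A ->
        x \in B -> y \in B -> x != y -> i = j].

Definition rainbow (J : {set I}) (f : I -> {set V}) : Prop :=
  (forall i, i \in J -> f i \in G i) /\
  {in J &, forall i j, i != j -> [disjoint f i & f j]}.

(** Stated through the set of colors, since a rainbow matching is a choice of
    one line for each color of a set. *)
Definition rainbow_free (k : nat) : Prop :=
  forall J f, rainbow J f -> #|J| = k -> False.

Hypothesis sysG : colored_system.
Let card_line i A : A \in G i -> #|A| = q. Proof. by case: sysG => h _ _; apply: h. Qed.
Let disj_color i : disjoint_family (G i). Proof. by case: sysG => _ h _; apply: h. Qed.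
Let color_eq i j A B x y : A \in G i -> B \in G j -> x \in A -> y \in A ->
  x \in B -> y \in B -> x != y -> i = j.
Proof. by case: sysG => _ _ h; apply: h. Qed.

Definition support_of (J : {set I}) (f : I -> {set V}) : {set V} :=
  \bigcup_(i in J) f i.

Lemma card_support_of J f : rainbow J f -> #|support_of J f| <= #|J| * q.
Proof.
move=> [fG _]; rewrite /support_of -sum_nat_const.
elim/big_rec2: _ => [|i U n iJ le_nU]; first by rewrite cards0.
by rewrite cardsU (card_line (fG i iJ)); lia.
Qed.

Lemma rainbow1 i A : A \in G i -> rainbow [set i] (fun=> A).
Proof.
by move=> AG; split=> [j /set1P-> //|j k /set1P-> /set1P->]; rewrite eqxx.
Qed.

Lemma rainbow_add J f c A : rainbow J f -> c \notin J -> A \in G c ->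
    [disjoint A & support_of J f] ->
  rainbow (c |: J) (fun i => if i == c then A else f i).
Proof.
move=> [fG fD] cNJ AG dA.
have dAf j : j \in J -> [disjoint A & f j].
  by move=> jJ; apply: disjointWr dA; apply: (bigcup_sup j).
split=> [i|i j]; rewrite !inE.
  by case: eqP => [->|_ /=]; [| apply: fG].
case: (altP (i =P c)) => [->|ic] /=; case: (altP (j =P c)) => [->|jc] //=.
- by rewrite eqxx.
- by move=> _ jJ _; apply: dAf.
- by move=> iJ _ _; rewrite disjoint_sym; apply: dAf.
exact: fD.
Qed.

(** The lines chosen so far have at most #|J| * q points, and each of these
    points blocks at most one line of color c. *)
Lemma rainbow_greedy J f c : rainbow J f -> c \notin J -> #|J| * q < #|G c| ->
  exists2 A, A \in G c & [disjoint A & support_of J f].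
Proof.
move=> rf cNJ big_c; apply/exists_inP; apply: contraTT big_c => /exists_inPn noA.
rewrite -leqNgt; apply: leq_trans (card_support_of rf).
by apply: leq_card_meeting => //; exact: disj_color.
Qed.

(** Greedy extension by n colors.  The hypothesis is Hall's condition for
    choosing n distinct colors of which the m-th (from 0) has more than
    (#|K| + m) * q lines: the thresholds are nested, so it is enough that
    the m-th one leaves n - m candidates.  The most demanding color is reserved
    first and its line chosen last. *)
Lemma rainbow_extend K f n (C : {set I}) : rainbow K f -> [disjoint C & K] ->
    (forall m, m < n -> n - m <= #|[set i in C | (#|K| + m) * q < #|G i|]|) ->
  exists (J : {set I}) (g : I -> {set V}), [/\ J \subset C, #|J| = n, rainbow (K :|: J) g
    & {in K, f =1 g}].
Proof.
move=> rf; elim: n C => [|n IHn] C dCK manyC.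
  by exists set0, f; rewrite sub0set cards0 setU0.
(* This color is set aside: it has enough lines to avoid all others. *)
have [c] : exists c, c \in [set i in C | (#|K| + n) * q < #|G i|].
  by apply/set0Pn; rewrite -card_gt0; have := manyC n (ltnSn n); lia.
rewrite inE => /andP[cC big_c].
have cNK : c \notin K by apply/negP => cK; apply: disjoint_notin dCK cC cK.
have [||J [g [JC cardJ rg eq_fg]]] := IHn (C :\ c).
- by apply: disjointWl dCK; apply: subsetDl.
- move=> m lt_mn; have := manyC m (ltnW lt_mn); rewrite (cardsD1 c) => le_n.
  have -> : [set i in C :\ c | (#|K| + m) * q < #|G i|] =
            [set i in C | (#|K| + m) * q < #|G i|] :\ c.
    by apply/setP=> i; rewrite !inE andbA.
  by move: le_n; case: (_ \in _); lia.
have cNJ : c \notin J by apply/negP => /(subsetP JC); rewrite !inE eqxx.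
have cNKJ : c \notin K :|: J by rewrite inE negb_or cNK.
have dKJ : [disjoint K & J].
  rewrite disjoint_sym; apply: disjointWl dCK.
  exact: subset_trans JC (subsetDl _ _).
have cardKJ : #|K :|: J| = #|K| + n.
  by rewrite cardsU disjoint_setI0 // cards0 subn0 cardJ.
have [|A AG dA] := rainbow_greedy rg cNKJ; first by rewrite cardKJ.
exists (c |: J), (fun i => if i == c then A else g i); split.
- rewrite subUset sub1set cC; exact: subset_trans JC (subsetDl _ _).
- by rewrite cardsU1 cNJ cardJ.
- by rewrite setUCA; apply: rainbow_add.
- by move=> i iK; case: eqP => [ic|_]; [rewrite -ic iK in cNK | apply: eq_fg].
Qed.

(** If the conclusion failed for all m <= t, the condition of [rainbow_extend]
    would hold with K empty and n = t + 1. *)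
Lemma rainbow_free_few_large t : rainbow_free t.+1 ->
  exists2 m, m <= t & #|[set i | m * q < #|G i|]| <= t - m.
Proof.
move=> free.
case: (boolP [exists m : 'I_t.+1, #|[set i | m * q < #|G i|]| <= t - m]).
  by case/existsP=> m le_m; exists m; rewrite // -ltnS.
rewrite negb_exists => /forallP large; exfalso.
have rain0 : rainbow set0 (fun=> set0) by split=> [i|i j]; rewrite inE.
have [||J [g [_ cardJ rg _]]] := @rainbow_extend set0 _ t.+1 setT rain0.
- by rewrite -setI_eq0 setI0.
- move=> m lt_mt; have := large (Ordinal lt_mt); rewrite -ltnNge /=.
  rewrite cards0 add0n.
  have -> : [set i in [set: I] | m * q < #|G i|] = [set i | m * q < #|G i|].
    by apply/setP=> i; rewrite !inE.
  by rewrite -subSn.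
by apply: free cardJ; rewrite set0U in rg; apply: rg.
Qed.

(** * Systems with t * q lines of each color *)
Section FullSystems.
Variable t : nat.
Hypotheses (t_ge2 : 2 <= t) (t_le_q : t <= q) (cardI : #|I| = q.+1).
Hypothesis free : rainbow_free t.+1.
Hypothesis full : forall i, #|G i| = t * q.

(** There are q + 1 > t colors, so at least t remain when c is excluded; and
    every color has t * q lines, enough to extend up to size t. *)
Lemma rainbow_complete K f c : rainbow K f -> c \notin K -> #|K| <= t ->
  exists (J : {set I}) (g : I -> {set V}),
    [/\ K \subset J, c \notin J, #|J| = t, rainbow J g & {in K, f =1 g}].
Proof.
move=> rf cNK le_Kt; pose C := ~: (c |: K).
have cardC : #|C| = q - #|K|.
  by have := cardsC (c |: K); rewrite cardsU1 cNK cardI -/C; lia.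
have dCK : [disjoint C & K].
  by rewrite disjoint_sym disjoints_subset setCK subsetUr.
have [m lt_m|J [g [JC cardJ rg eq_fg]]] := @rainbow_extend K f (t - #|K|) C rf dCK.
  have -> : [set i in C | (#|K| + m) * q < #|G i|] = C.
    apply/setP=> i; rewrite inE full ltn_pmul2r; last by lia.
    by rewrite (_ : #|K| + m < t) ?andbT //; lia.
  by rewrite cardC; lia.
have dKJ : [disjoint K & J] by rewrite disjoint_sym; apply: disjointWl dCK.
exists (K :|: J), g; split=> //; first exact: subsetUl.
  rewrite inE negb_or cNK; apply/negP=> /(subsetP JC).
  by rewrite !inE eqxx.
by rewrite cardsU disjoint_setI0 // cards0 cardJ; lia.
Qed.

(** A line of color c disjoint from the transversal would complete it to a
    forbidden rainbow matching of size t + 1.  So the t * q lines of color c all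
    meet its t * q points, and [meeting_tight] applies. *)
Lemma transversal_tight J g c : rainbow J g -> #|J| = t -> c \notin J ->
  (forall A, A \in G c -> #|A :&: support_of J g| = 1) /\
  support_of J g \subset cover (G c).
Proof.
move=> rg cardJ cNJ; apply: meeting_tight => [|A AG|].
- exact: disj_color.
- apply/negP=> dA; apply: (free (rainbow_add rg cNJ AG dA)).
  by rewrite cardsU1 cNJ cardJ.
- by rewrite full -cardJ; apply: card_support_of.
Qed.

(** A belongs to a transversal that avoids c, and its points are all covered by
    the lines of color c. *)
Lemma line_through i A c x : A \in G i -> x \in A -> exists2 C, C \in G c & x \in C.
Proof.
move=> AG xA; case: (altP (c =P i)) => [->|neq_ci]; first by exists A.
have [||J [g [iJ cNJ cardJ rg eq_g]]] := rainbow_complete (c := c) (rainbow1 AG).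
- by rewrite inE.
- by rewrite cards1; lia.
have [_ /subsetP/(_ x)] := transversal_tight rg cardJ cNJ.
case/(_ _)/bigcupP=> [|C CG xC]; last by exists C.
apply/bigcupP; exists i; first by rewrite (subsetP iJ) ?set11.
by rewrite -eq_g ?set11.
Qed.

(** If A and B were disjoint they would belong to a transversal avoiding the
    color of C; but C meets such a transversal in one point only. *)
Lemma meet_of_common_transversal i j k A B C :
    A \in G i -> B \in G j -> C \in G k -> i != j -> k != i -> k != j ->
    ~~ [disjoint C & A] -> ~~ [disjoint C & B] ->
  ~~ [disjoint A & B].
Proof.
move=> AG BG CG ij ki kj /meetP[x xC xA] /meetP[y yC yB]; apply/negP=> dAB.
have iNj : i \notin [set j] by rewrite inE.
have dA : [disjoint A & support_of [set j] (fun=> B)].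
  by rewrite /support_of big_set1.
have [||J [g [KJ cNJ cardJ rg eq_g]]] :=
  rainbow_complete (c := k) (rainbow_add (rainbow1 BG) iNj AG dA).
- by rewrite !inE negb_or ki.
- by rewrite cardsU1 iNj cards1.
have [/(_ C CG)/eqP/cards1P[z def_z] _] := transversal_tight rg cardJ cNJ.
have xz : x = z.
  apply/set1P; rewrite -def_z inE xC; apply/bigcupP; exists i.
    by rewrite (subsetP KJ) // !inE eqxx.
  by rewrite -eq_g ?eqxx // !inE eqxx.
have yz : y = z.
  apply/set1P; rewrite -def_z inE yC; apply/bigcupP; exists j.
    by rewrite (subsetP KJ) // !inE eqxx orbT.
  by rewrite -eq_g ?inE ?eqxx ?orbT // eq_sym (negPf ij).
by apply: disjoint_notin dAB xA _; rewrite xz -yz.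
Qed.

(** The form of [meet_of_common_transversal] that follows a pencil: with A
    through a given point x and meeting B, all lines C through x of colors other
    than that of B meet B.  Here C may have the color of A. *)
Lemma meet_transfer i j k A B C :
    A \in G i -> B \in G j -> C \in G k -> i != j -> k != j ->
    ~~ [disjoint C & A] -> ~~ [disjoint A & B] ->
  ~~ [disjoint C & B].
Proof.
move=> AG BG CG ij kj meetCA meetAB.
case: (altP (k =P i)) => [ki|ki].
  case/meetP: meetCA => x xC xA; rewrite ki in CG.
  by rewrite (disj_color CG AG xC xA).
by apply: (meet_of_common_transversal CG BG AG) => //; rewrite 1?eq_sym // disjoint_sym.
Qed.

(** * Collinearity and its classes *)
Definition collinear (x y : V) : bool :=
  [exists c, [exists A in G c, (x \in A) && (y \in A)]].

Lemma collinearP x y :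
  reflect (exists c A, [/\ A \in G c, x \in A & y \in A]) (collinear x y).
Proof.
apply: (iffP existsP) => [[c /exists_inP[A AG /andP[xA yA]]] | [c [A [AG xA yA]]]].
  by exists c, A.
by exists c; apply/exists_inP; exists A; rewrite ?xA.
Qed.

Lemma collinear_sym x y : collinear x y = collinear y x.
Proof.
by apply/collinearP/collinearP => -[c [A [AG xA yA]]]; exists c, A.
Qed.

(** The q lines through x of colors other than j meet B ([meet_transfer]), in
    distinct points as x is off B, so they reach all q points of B. *)
Lemma collinear_line i j A B x : A \in G i -> B \in G j -> i != j ->
    ~~ [disjoint A & B] -> x \in A -> x \notin B ->
  forall z, z \in B -> collinear x z.
Proof.
move=> AG BG ij meetAB xA xNB.
have hit k : exists z, k != j -> z \in B /\ exists C, [/\ C \in G k, x \in C & z \in C].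
  case: (altP (k =P j)) => [_|kj]; first by exists x.
  have [C CG xC] := line_through k AG xA.
  have /meetP[z zC zB] : ~~ [disjoint C & B].
    by apply: (meet_transfer AG BG CG) => //; apply/meetP; exists x.
  by exists z => _; split=> //; exists C.
(* For k != j, h k is the point where the line of color k through x meets B. *)
have [h hP] := fin_all_exists hit.
have h_inj : {in [set~ j] &, injective h}.
  move=> k l; rewrite !inE => kj lj eq_h.
  have [hB [C [CG xC hC]]] := hP k kj; have [_ [D [DG xD hD]]] := hP l lj.
  rewrite -eq_h in hD; apply: (color_eq CG DG xC hC xD hD).
  by apply: contraNneq xNB => ->.
have hB : h @: [set~ j] = B.
  apply/eqP; rewrite eqEcard card_in_imset // cardsC1 cardI /= (card_line BG) leqnn andbT.
  by apply/subsetP=> _ /imsetP[k kj ->]; rewrite !inE in kj; case: (hP k kj).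
move=> z; rewrite -hB => /imsetP[k kj ->]; rewrite !inE in kj.
by case: (hP k kj) => _ [C [CG xC hC]]; apply/collinearP; exists k, C.
Qed.

Lemma collinear_trans y x z : collinear x y -> collinear y z -> collinear x z.
Proof.
move=> /collinearP[i [A [AG xA yA]]] /collinearP[j [B [BG yB zB]]].
case: (altP (i =P j)) => [ij|ij].
  apply/collinearP; exists i, A; split=> //; rewrite -ij in BG.
  by rewrite (disj_color AG BG yA yB).
case: (boolP (x \in B)) => xB; first by apply/collinearP; exists j, B.
by apply: (collinear_line AG BG ij) => //; apply/meetP; exists y.
Qed.

(** These classes will be the point sets of the affine planes. *)
Definition packet (x : V) : {set V} := [set y | collinear x y].

(** The line through x and y meets A and B, so [meet_transfer] applies to it. *)
Lemma meet_in_packet i j A B x y : A \in G i -> B \in G j -> i != j ->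
  x \in A -> y \in B -> collinear x y -> ~~ [disjoint A & B].
Proof.
move=> AG BG ij xA yB /collinearP[k [C [CG xC yC]]].
have meetCA : ~~ [disjoint C & A] by apply/meetP; exists x.
have meetCB : ~~ [disjoint C & B] by apply/meetP; exists y.
case: (altP (k =P j)) => [kj|kj].
  rewrite kj in CG.
  by rewrite disjoint_sym -(disj_color CG BG yC yB).
by apply: (meet_transfer CG BG AG) => //; rewrite disjoint_sym.
Qed.

(** The pencil at x consists of one line of each of the q + 1 colors, and these
    lines have q - 1 further points each, all different. *)
Lemma card_packet x : collinear x x -> #|packet x| = q ^ 2.
Proof.
case/collinearP=> i [A [AG xA _]].
have lines c : exists C, C \in G c /\ x \in C.
  by have [C] := line_through c AG xA; exists C.
have [C CP] := fin_all_exists lines.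
have pencil : packet x = x |: \bigcup_c (C c :\ x).
  apply/setP=> y; rewrite !inE; case: (altP (y =P x)) => [->|yx] /=.
    by apply/collinearP; exists i, A.
  apply/collinearP/bigcupP => [[c [B [BG xB yB]]] | [c _]].
    have [CG xC] := CP c; exists c => //.
    by rewrite !inE yx (disj_color CG BG xC xB).
  by rewrite !inE => /andP[_ yC]; have [CG xC] := CP c; exists c, (C c).
rewrite pencil cardsU1; have -> /= : x \notin \bigcup_c (C c :\ x).
  by apply/bigcupP=> -[c _]; rewrite !inE eqxx.
have dC c d : c != d -> [disjoint C c :\ x & C d :\ x].
  apply: contraNT => /meetP[y]; rewrite !inE => /andP[yx yC] /andP[_ yD].
  have [CG xC] := CP c; have [DG xD] := CP d.
  by apply/eqP; apply: (color_eq CG DG yC xC yD xD).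
rewrite -sum1_card (partition_disjoint_bigcup _ _ dC).
under eq_bigr => c _.
  rewrite sum1_card (_ : #|C c :\ x| = q.-1); last first.
    have [CG xC] := CP c; have := cardsD1 x (C c).
    by rewrite xC (card_line CG) => ->.
  over.
by rewrite sum_nat_const cardI; case: q t_le_q t_ge2 => [|q']; [lia | nia].
Qed.


(** * The classes are affine planes *)
Definition lines_in (W : {set V}) (i : I) : {set {set V}} :=
  [set A in G i | A \subset W].

Lemma packet_collinear x y z :
  y \in packet x -> z \in packet x -> collinear y z.
Proof.
by rewrite !inE => xy xz; apply: (collinear_trans _ xz); rewrite collinear_sym.
Qed.

Lemma line_sub_packet x i A y :
  A \in G i -> y \in A -> y \in packet x -> A \subset packet x.
Proof.
move=> AG yA; rewrite inE => xy; apply/subsetP=> z zA; rewrite inE.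
by apply: (collinear_trans xy); apply/collinearP; exists i, A.
Qed.

Lemma lines_in_meet x i j A B : A \in lines_in (packet x) i ->
  B \in lines_in (packet x) j -> i != j -> ~~ [disjoint A & B].
Proof.
rewrite !inE => /andP[AG AW] /andP[BG BW] ij.
have [|y yA] := @set0Pn _ A _.
  by rewrite -card_gt0 (card_line AG); lia.
have [|z zB] := @set0Pn _ B _.
  by rewrite -card_gt0 (card_line BG); lia.
apply: (meet_in_packet AG BG ij yA zB).
by apply: (packet_collinear (x := x)); [apply: (subsetP AW) | apply: (subsetP BW)].
Qed.

Lemma line_in_packet_through x y i : y \in packet x ->
  exists2 A, A \in lines_in (packet x) i & y \in A.
Proof.
move=> yW; have /collinearP[j [B [BG xB yB]]] : collinear x y by rewrite inE in yW.
have [A AG yA] := line_through i BG yB; exists A => //.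
by rewrite inE AG (line_sub_packet AG yA yW).
Qed.

(** The parallel to l through y is the line of the same color: a line of any
    other color in the same class meets l ([lines_in_meet]). *)
Lemma packet_affine x : collinear x x ->
  affine_plane q (packet x) (\bigcup_i lines_in (packet x) i).
Proof.
move=> xx; set W := packet x; set L := \bigcup_i _.
have LP l : reflect (exists2 i, l \in G i & l \subset W) (l \in L).
  apply: (iffP bigcupP) => [[i _] | [i lG lW]].
    by rewrite inE => /andP[lG lW]; exists i.
  by exists i => //; rewrite inE lG.
have join : unique_joining_line W L.
  move=> y z yW zW yz.
  have /collinearP[i [A [AG yA zA]]] := packet_collinear yW zW.
  exists A; split.
    by split=> //; apply/LP; exists i; rewrite // (line_sub_packet AG yA yW).
  move=> B [/LP[j BG _] yB zB]; have ij := color_eq AG BG yA zA yB zB yz.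
  by rewrite -ij in BG; apply: (disj_color AG BG yA yB).
split=> [l|//|y l|].
- by move=> /LP[i lG lW]; split=> //; apply: card_line lG.
- move=> yW /LP[i lG lW] yNl.
  have [m mL ym] := line_in_packet_through i yW.
  move: mL; rewrite inE => /andP[mG mW]; exists m; split.
    split=> //; first by apply/LP; exists i.
    apply: contraNT yNl => /meetP[z zm zl].
    by rewrite -(disj_color mG lG zm zl).
  move=> m' [/LP[j m'G m'W] ym' dm'].
  case: (altP (j =P i)) => [ji|ji].
    by rewrite ji in m'G; apply: (disj_color mG m'G ym ym').
  suff : ~~ [disjoint m' & l] by rewrite dm'.
  by apply: (lines_in_meet (x := x) _ _ ji); rewrite inE ?m'G ?lG.
have xW : x \in W by rewrite inE.
have /collinearP[i [A [AG xA _]]] := xx.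
have [y] : exists y, y \in A :\ x.
  apply/set0Pn; rewrite -card_gt0; have := cardsD1 x A.
  by rewrite xA (card_line AG); lia.
rewrite !inE => /andP[yx yA].
have AW : A \subset W by apply: line_sub_packet AG xA xW.
have /subsetPn[z zW zNA] : ~~ (W \subset A).
  apply/negP=> /subset_leq_card; rewrite card_packet // (card_line AG).
  by have := ltn_Pmull (m := q) (n := q); rewrite -mulnn; nia.
exists [set x; y; z]; split.
- by rewrite !subUset !sub1set xW zW (subsetP AW).
- have zNx : z != x by apply: contraNneq zNA => ->.
  have zNy : z != y by apply: contraNneq zNA => ->.
  by rewrite setUC cardsU1 !inE (negPf zNx) (negPf zNy) cards2 eq_sym yx.
move=> l lL; apply/negP; rewrite !subUset !sub1set => /andP[/andP[xl yl] zl].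
have [m [_ uniq_m]] := join x y xW (subsetP AW y yA) (contra_neq (fun h => esym h) yx).
have mA : m = A by apply: uniq_m; split=> //; apply/LP; exists i.
have ml : m = l by apply: uniq_m.
by rewrite -mA ml zl in zNA.
Qed.

Lemma lines_in_color_inj x i j A : A \in lines_in (packet x) i ->
  A \in lines_in (packet x) j -> i = j.
Proof.
move=> Ai Aj; apply/eqP; apply: contraTT isT => ij.
move: (Ai) (Aj); rewrite !inE => /andP[AG _] /andP[AG' _].
have /card_gt1P[y [z [yA zA yz]]] : 1 < #|A| by rewrite (card_line AG); lia.
by case/eqP: ij; apply: (color_eq AG AG' yA zA yA zA yz).
Qed.

(** Inside one class, lines are disjoint or equal exactly when they have the same
    color. *)
Lemma packet_parallel_classes x : collinear x x ->
  parallel_classes (\bigcup_i lines_in (packet x) i) =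
  [set lines_in (packet x) i | i : I].
Proof.
move=> xx; set L := \bigcup_i _.
have xW : x \in packet x by rewrite inE.
have class i l : l \in lines_in (packet x) i ->
    [set m in L | parallel l m] = lines_in (packet x) i.
  move=> li; apply/setP=> m; rewrite in_set; apply/andP/idP => [[/bigcupP[j _ mj]] | mi].
    rewrite /parallel; case: (altP (i =P j)) => [->//|ij].
    rewrite (negPf (lines_in_meet li mj ij)) orbF => /eqP lm.
    by rewrite -lm.
  split; first by apply/bigcupP; exists i.
  rewrite /parallel; case: eqVneq => //= lm; apply: contra_neqT lm => /meetP[z zl zm].
  by move: li mi; rewrite !inE => /andP[lG _] /andP[mG _]; apply: (disj_color lG mG zl zm).
apply/setP=> c; apply/imsetP/imsetP => [[l /bigcupP[i _ li] ->] | [i _ ->]].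
  by exists i => //; apply: class.
have [l li xl] := line_in_packet_through i xW.
by exists l; [apply/bigcupP; exists i | rewrite (class i)].
Qed.

(** The classes of collinearity partition the t * q^2 points covered by any one
    color into sets of size q^2, so that there are t of them. *)
Lemma affine_decomposition :
  exists (Omega : 'I_t -> {set V}) (F : I -> 'I_t -> {set {set V}}),
  [/\ (forall b, #|Omega b| = q ^ 2) /\
        (forall b c, b != c -> [disjoint Omega b & Omega c]),
      forall i, G i = \bigcup_b F i b,
      forall i b c, b != c -> [disjoint F i b & F i c],
      forall b, affine_plane q (Omega b) (\bigcup_i F i b)
    & forall b, injective (F^~ b) /\
        parallel_classes (\bigcup_i F i b) = [set F i b | i : I]].
Proof.
pose X : {set V} := [set x | collinear x x].
have XG i : cover (G i) = X.
  apply/setP=> x; rewrite inE; apply/bigcupP/collinearP => [[A AG xA] | [j [A [AG xA _]]]].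
    by exists i, A.
  by have [B BG xB] := line_through i AG xA; exists B.
pose P := equivalence_partition collinear X.
have partP : partition P X.
  apply: equivalence_partitionP => x y z; rewrite !inE => _ _ zz; split=> // xy.
  have yx : collinear y x by rewrite collinear_sym.
  by apply/idP/idP => [/(collinear_trans yx) | /(collinear_trans xy)].
have classP W : W \in P -> exists2 x, collinear x x & W = packet x.
  case/imsetP=> x; rewrite inE => xx ->; exists x => //.
  apply/setP=> y; rewrite !inE andb_idl // => xy.
  by apply: (collinear_trans _ xy); rewrite collinear_sym.
have cardW W : W \in P -> #|W| = q ^ 2.
  by case/classP=> x xx ->; apply: card_packet.
have cardP : #|P| = t.
  have [i _] : exists i : I, i \in [set: I].
    by apply/set0Pn; rewrite -card_gt0 cardsT cardI.
  have := card_uniform_partition cardW partP.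
  have tiG : trivIset (G i).
    apply/trivIsetP=> A B AG BG; apply: contraNT => /meetP[x xA xB].
    by apply/eqP; apply: (disj_color AG BG xA xB).
  rewrite -(XG i) -(eqP tiG) (eq_bigr (fun=> q)) => [|A AG]; last exact: card_line AG.
  rewrite sum_nat_const full -mulnA mulnn => /eqP.
  by rewrite eqn_pmul2r => [/eqP//|]; rewrite expn_gt0; lia.
pose Omega (b : 'I_t) := enum_val (cast_ord (esym cardP) b).
have OmegaP b : Omega b \in P by apply: enum_valP.
have disjO b c : b != c -> [disjoint Omega b & Omega c].
  have /and3P[_ /trivIsetP tiP _] := partP.
  move=> bc; apply: tiP => //; apply: contra bc => /eqP/enum_val_inj/cast_ord_inj ->.
  by rewrite eqxx.
exists Omega, (fun i b => lines_in (Omega b) i); split.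
- by split=> // b; apply: cardW.
- move=> i; apply/setP=> A; apply/idP/bigcupP => [AG | [b _]]; last first.
    by rewrite inE => /andP[].
  have [|x xA] := @set0Pn _ A _; first by rewrite -card_gt0 (card_line AG); lia.
  have : x \in cover P by rewrite (cover_partition partP) -(XG i); apply/bigcupP; exists A.
  case/bigcupP=> W WP xW; exists (cast_ord cardP (enum_rank_in WP W)) => //.
  have -> : Omega (cast_ord cardP (enum_rank_in WP W)) = W.
    by rewrite /Omega cast_ordK enum_rankK_in.
  have [y yy defW] := classP W WP; rewrite defW in xW *.
  by rewrite inE AG (line_sub_packet AG xA xW).
- move=> i b c bc; apply/negP=> /negP/meetP[A]; rewrite !inE => /andP[AG Ab] /andP[_ Ac].
  have [|x xA] := @set0Pn _ A _; first by rewrite -card_gt0 (card_line AG); lia.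
  by apply: disjoint_notin (disjO b c bc) (subsetP Ab x xA) (subsetP Ac x xA).
- by move=> b; have [x xx ->] := classP _ (OmegaP b); apply: packet_affine.
move=> b; have [x xx ->] := classP _ (OmegaP b); split.
  move=> i j eq_ij; have [|A Ai _] := @line_in_packet_through x x i; first by rewrite inE.
  by apply: (lines_in_color_inj Ai); rewrite -eq_ij.
exact: packet_parallel_classes.
Qed.

End FullSystems.

End ColoredSystems.

(** * Petals in a linear hypergraph *)
Section Linear.
Variables (V : finType) (E : {set {set V}}) (e : {set V}).
Hypotheses (E_lin : linear_hypergraph E) (eE : e \in E).

Lemma linear_edge_eq f g x y : f \in E -> g \in E -> x \in f -> y \in f ->
  x \in g -> y \in g -> x != y -> f = g.
Proof.
move=> fE gE xf yf xg yg xy; apply: contraTeq xy => /(E_lin fE gE).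
by rewrite negbK => /card_le1_eqP le1; apply/eqP/le1; rewrite inE ?xf ?yf.
Qed.

Lemma petalP x (A : {set V}) : reflect [/\ x \notin A, x |: A \in E & x |: A != e]
                           (A \in petal_family E e x).
Proof.
apply: (iffP imsetP) => [[f + ->] | [xNA xAE neq]].
  by rewrite !inE => /andP[/andP[fe fE] xf]; rewrite setD1K // eqxx.
by exists (x |: A); rewrite ?setU1K // !inE neq xAE eqxx.
Qed.

Lemma deg_petal_family x : x \in e -> deg E x = (#|petal_family E e x|).+1.
Proof.
move=> xe; rewrite /deg (cardsD1 e) inE eE xe add1n; congr _.+1.
rewrite card_in_imset.
  by apply: eq_card => f; rewrite !inE andbA.
move=> f g; rewrite !inE => /andP[_ xf] /andP[_ xg] eq_fg.
by rewrite -(setD1K xf) eq_fg setD1K.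
Qed.

Lemma petal_disjoint_base x (A : {set V}) : x \in e -> A \in petal_family E e x ->
  [disjoint A & e].
Proof.
move=> xe /petalP[xNA xAE]; apply: contraNT => /meetP[y yA ye]; apply/eqP.
apply: (linear_edge_eq xAE eE _ _ xe ye); rewrite ?setU11 //; last first.
  by apply: contraNneq xNA => ->.
exact: setU1r.
Qed.

End Linear.

(** * Parallel classes of an affine plane *)
Section AffinePlanes.
Variables (V : finType) (n : nat) (P : {set V}) (L C : {set {set V}}).
Hypotheses (planeP : affine_plane n P L) (classC : C \in parallel_classes L).

Lemma parallel_class_lines m : m \in C -> m \in L.
Proof. by case/imsetP: classC => l _ ->; rewrite inE => /andP[]. Qed.

(** Two members of the class of l through a point x are both equal to l if x is
    on l, and both the parallel to l through x otherwise. *)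
Lemma parallel_class_disjoint : disjoint_family C.
Proof.
case: planeP => line_L _ parP _; case/imsetP: classC => l lL -> m m' x.
rewrite !inE => /andP[mL lm] /andP[m'L lm'] xm xm'.
have meet k : parallel l k -> x \in k -> x \in l -> l = k.
  by case/orP=> [/eqP //|dlk] xk xl; case: (disjoint_notin dlk xl xk).
case: (boolP (x \in l)) => xl; first by rewrite -(meet m) // (meet m').
have avoid k : parallel l k -> x \in k -> [disjoint k & l].
  by case/orP=> [/eqP<- /(negP xl) //|]; rewrite disjoint_sym.
have xP : x \in P by have [/subsetP mP _] := line_L m mL; apply: mP.
have [k [_ uniq_k]] := parP x l xP lL xl.
by rewrite -(uniq_k m) ?(uniq_k m') //; split=> //; apply: avoid.
Qed.

Lemma parallel_class_cover : cover C = P.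
Proof.
case: planeP => line_L _ parP _; have subCL := parallel_class_lines.
apply/eqP; rewrite eqEsubset; apply/andP; split.
  by apply/bigcupsP=> m /subCL mL; have [] := line_L m mL.
case/imsetP: classC => l lL ->; apply/subsetP=> x xP; apply/bigcupP.
case: (boolP (x \in l)) => xl; first by exists l; rewrite // inE lL /parallel eqxx.
have [k [[kL xk dk] _]] := parP x l xP lL xl.
by exists k; rewrite // inE kL /parallel disjoint_sym dk orbT.
Qed.

(** The lines of a parallel class have n points each and partition the n^2
    points. *)
Lemma card_parallel_class : 0 < n -> #|P| = n ^ 2 -> #|C| = n.
Proof.
move=> n_gt0 cardP; case: planeP => line_L _ _ _.
have := sum_card_setI P parallel_class_disjoint.
rewrite parallel_class_cover setIid cardP (eq_bigr (fun=> n)) => [|m mC].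
  by rewrite sum_nat_const -mulnn => /eqP; rewrite eqn_pmul2r // => /eqP.
by have [/setIidPl-> ->] := line_L m (parallel_class_lines mC).
Qed.

End AffinePlanes.

(** * Sums of reciprocal degrees *)
Section ReciprocalSums.
Import Order.TTheory GRing.Theory Num.Theory.
Local Open Scope ring_scope.
Variables (I : finType) (g : I -> nat).

(** Each term is at least the average that the sum prescribes, so all terms are
    equal to it. *)
Lemma recip_sum_tight D : (forall i, g i <= D)%N ->
  \sum_i (g i).+1%:R^-1 = #|I|%:R / D.+1%:R :> rat -> forall i, g i = D.
Proof.
move=> le_gD eq_sum i.
have /psumr_eq0P zero : forall i, true -> 0 <= (g i).+1%:R^-1 - D.+1%:R^-1 :> rat.
  by move=> j _; rewrite subr_ge0 lef_pV2 ?posrE ?ltr0n // ler_nat ltnS.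
have /eqP : (g i).+1%:R^-1 - D.+1%:R^-1 = 0 :> rat.
  by apply: zero => //; rewrite sumrB eq_sum sumr_const mulr_natl subrr.
by rewrite subr_eq0 => /eqP/invr_inj/eqP; rewrite eqr_nat eqSS => /eqP.
Qed.

(** At least q + 1 - (t - m) terms are at least 1/(mq+1).  With s = t - m > 0,
    (q+1-s)(tq+1) - (q+1)((t-s)q+1) = s ((q+1-t) q - 1) > 0. *)
Lemma recip_sum_large t q m : (t <= q)%N -> (1 < q)%N -> #|I| = q.+1 ->
    (m < t)%N -> (#|[set i | m * q < g i]| <= t - m)%N ->
  q.+1%:R / (t * q).+1%:R < \sum_i (g i).+1%:R^-1 :> rat.
Proof.
move=> le_tq q_gt1 cardI lt_mt few; set S := [set i | _] in few.
have cardS : (q.+1 - (t - m) <= #|~: S|)%N by have := cardsC S; rewrite cardI; lia.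
apply: (@lt_le_trans _ _ (#|~: S|%:R / (m * q).+1%:R)).
  rewrite ltr_pdivrMr ?ltr0n // mulrAC ltr_pdivlMr ?ltr0n // -!natrM ltr_nat.
  have : ((q.+1 - (t - m)) * (t * q).+1 <= #|~: S| * (t * q).+1)%N.
    by rewrite leq_mul2r cardS orbT.
  apply: leq_trans.
  have /subnKC : (m <= t)%N by lia.
  have : (0 < t - m)%N by lia.
  move: (t - m)%N => s s_gt0 def_t.
  have -> : (q.+1 - s = (q - t) + m + 1)%N by lia.
  move: (q - t)%N (subnKC le_tq) => r def_q.
  nia.
rewrite mulr_natl -sumr_const.
rewrite [leRHS](bigID (mem (~: S))) /= -[leLHS]addr0 lerD //; last first.
  by apply: sumr_ge0 => i _; rewrite invr_ge0 ler0n.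
apply: ler_sum => i; rewrite !inE -leqNgt => le_gi.
by rewrite lef_pV2 ?posrE ?ltr0n // ler_nat ltnS.
Qed.

End ReciprocalSums.

(** * The petal trace of an edge *)
Section PetalTrace.
Variables (t q : nat) (V : finType) (E : {set {set V}}) (e : {set V}).
Variable v : 'I_q.+1 -> V.
Hypotheses (t_ge2 : 2 <= t) (t_le_q : t <= q).
Hypotheses (E_unif : uniform_hypergraph E q.+1) (E_lin : linear_hypergraph E).
Hypotheses (eE : e \in E) (v_inj : injective v).
Hypothesis e_def : e = [set v i | i : 'I_q.+1].

Local Notation petals i := (petal_family E e (v i)).

Let v_in i : v i \in e. Proof. by rewrite e_def imset_f. Qed.

Lemma petal_system : colored_system q (fun i => petals i).
Proof.
split=> [i A /petalP[vNA /E_unif]|i A B x /petalP[vNA AE _] /petalP[vNB BE _] xA xB|].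
- by rewrite cardsU1 vNA => -[].
- suff eqAB : v i |: A = v i |: B by rewrite -(setU1K vNA) eqAB setU1K.
  apply: (linear_edge_eq E_lin AE BE (x := v i) (y := x)); rewrite ?setU11 ?setU1r //.
  by apply: contraNneq vNA => ->.
move=> i j A B x y AG BG xA yA xB yB xy.
have dAe := petal_disjoint_base E_lin eE (v_in i) AG.
have dBe := petal_disjoint_base E_lin eE (v_in j) BG.
move: AG BG => /petalP[_ AE _] /petalP[_ BE _].
have eqAB : v i |: A = v j |: B.
  by apply: (linear_edge_eq E_lin AE BE (x := x) (y := y)); rewrite ?setU1r.
have : v i \in v j |: B by rewrite -eqAB setU11.
case/setU1P=> [/v_inj //|viB]; by case: (disjoint_notin dBe viB (v_in i)).
Qed.

(** Restoring the base points v_i to the lines of a rainbow matching gives the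
    petals of a crown with base e. *)
Lemma petal_rainbow_free k : crown_free E k -> rainbow_free (fun i => petals i) k.
Proof.
move=> noCrown J f [fG fD] cardJ; subst k; apply: noCrown.
pose c (a : 'I_#|J|) := enum_val a.
have cJ a : c a \in J by apply: enum_valP.
have dfe a : [disjoint f (c a) & e] by apply: petal_disjoint_base (fG _ (cJ a)).
exists e, (fun a => v (c a) |: f (c a)), (fun a => v (c a)); split=> //.
- by move=> a; have /petalP[] := fG _ (cJ a).
- by move=> a b /v_inj/enum_val_inj.
- by move=> a; rewrite setIUr [_ :&: f _]setIC (disjoint_setI0 (dfe a)) setU0;
    apply/setIidPr; rewrite sub1set.
move=> a b ab; have cab : c a != c b by apply: contra ab => /eqP/enum_val_inj->.
apply/negP=> /negP/meetP[x] /setU1P[->|xa] /setU1P[vb|xb].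
- by rewrite (v_inj vb) eqxx in cab.
- exact: disjoint_notin (dfe b) xb (v_in _).
- by rewrite vb in xa; apply: disjoint_notin (dfe a) xa (v_in _).
exact: disjoint_notin (fD _ _ (cJ a) (cJ b) cab) xa xb.
Qed.

Lemma delta_petals : delta E q.+1 (t * q + 1) e =
  (\sum_i (#|petals i|).+1%:R^-1 - q.+1%:R / (t * q).+1%:R)%R.
Proof.
have sum_e (F : V -> rat) : (\sum_(x in e) F x = \sum_i F (v i))%R.
  by rewrite e_def big_imset //= => i j _ _; apply: v_inj.
rewrite /delta addn1 sum_e.
by congr (_ - _)%R; apply: eq_bigr => i _; rewrite (deg_petal_family eE (v_in i)).
Qed.

Lemma deg_full : (forall x, x \in e -> deg E x = t * q + 1) <->
  (forall i, #|petals i| = t * q).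
Proof.
split=> [degE i | full x].
  by have := degE _ (v_in i); rewrite (deg_petal_family eE (v_in i)) addn1 => -[].
rewrite {1}e_def => /imsetP[i _ ->].
by rewrite (deg_petal_family eE (v_in i)) full addn1.
Qed.

Lemma delta_eq0 : crown_free E t.+1 ->
  delta E q.+1 (t * q + 1) e = 0%R <-> (forall i, #|petals i| = t * q).
Proof.
move=> /petal_rainbow_free/(rainbow_free_few_large petal_system)[m le_mt few].
rewrite delta_petals; split=> [/eqP|full].
  rewrite GRing.subr_eq0 => /eqP eq_sum.
  case: (ltngtP m t) le_mt => // [lt_mt|eq_mt] _; last first.
    apply: recip_sum_tight => [i|]; last by rewrite eq_sum card_ord.
    move: few; rewrite eq_mt subnn leqn0 cards_eq0 => /eqP/setP/(_ i).
    by rewrite !inE => /negbT; rewrite -leqNgt.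
  have := recip_sum_large t_le_q (leq_trans t_ge2 t_le_q) (card_ord _) lt_mt few.
  by rewrite eq_sum Order.POrderTheory.ltxx.
under eq_bigr do rewrite full.
by rewrite GRing.sumr_const card_ord GRing.mulr_natl GRing.subrr.
Qed.


Lemma packets_of_full : crown_free E t.+1 -> (forall i, #|petals i| = t * q) ->
  exists (Omega : 'I_t -> {set V}) (F : 'I_q.+1 -> 'I_t -> {set {set V}}),
    affine_packets E e v Omega F.
Proof.
move=> /petal_rainbow_free free full.
exact: (affine_decomposition petal_system t_ge2 t_le_q (card_ord _) free full).
Qed.

(** * Projective completion of the affine packets *)
Section Packets.
Variables (Omega : 'I_t -> {set V}) (F : 'I_q.+1 -> 'I_t -> {set {set V}}).
Hypothesis packets : affine_packets E e v Omega F.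

Let F_class i b : F i b \in parallel_classes (packet_lines F b).
Proof. by case: packets => _ _ _ _ /(_ b)[_ ->]; apply: imset_f. Qed.

Let plane b : affine_plane q (Omega b) (packet_lines F b).
Proof. by case: packets. Qed.

Let card_Omega b : #|Omega b| = q ^ 2.
Proof. by case: packets => -[]. Qed.

Let F_petal i b A : A \in F i b -> A \in petals i.
Proof. by case: packets => _ -> _ _ _ AF; apply/bigcupP; exists b. Qed.

Let F_line i b A : A \in F i b -> A \in packet_lines F b.
Proof. by move=> AF; apply/bigcupP; exists i. Qed.

Let F_cover i b : cover (F i b) = Omega b.
Proof. exact: parallel_class_cover (plane b) (F_class i b). Qed.

Let F_sub i b A x : A \in F i b -> x \in A -> x \in Omega b.
Proof. by move=> AF xA; rewrite -(F_cover i); apply/bigcupP; exists A. Qed.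

Lemma full_of_packets i : #|petals i| = t * q.
Proof.
case: packets => _ -> disjF _ _; rewrite -sum1_card.
rewrite (partition_disjoint_bigcup _ _ (disjF i)).
under eq_bigr => b _ do rewrite sum1_card
  (card_parallel_class (plane b) (F_class i b) (ltnW (leq_trans t_ge2 t_le_q)) (card_Omega b)).
by rewrite sum_nat_const card_ord.
Qed.

(** Each point of the packet lies on a petal, and a petal loses its only point
    of e when it becomes a line. *)
Lemma packet_base_disjoint b : [disjoint Omega b & e].
Proof.
apply/negP=> /negP/meetP[x]; rewrite -(F_cover ord0) => /bigcupP[A AF xA].
exact: disjoint_notin (petal_disjoint_base E_lin eE (v_in _) (F_petal AF)) xA.
Qed.

(** If A and B were disjoint, B would be the parallel to A through one of its
    points x; but so is the line of color i through x, and B would be a petal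
    at both v_i and v_j. *)
Lemma packet_colors_meet i j b A B :
  A \in F i b -> B \in F j b -> i != j -> ~~ [disjoint A & B].
Proof.
move=> AF BF ij; apply/negP=> dAB; have [cardG _ color_eq] := petal_system.
have /card_gt1P[x [y [xB yB xy]]] : 1 < #|B|.
  by rewrite (cardG j B (F_petal BF)) (leq_trans t_ge2).
have /bigcupP[m mF xm] : x \in cover (F i b) by rewrite F_cover (F_sub BF xB).
have xNA : x \notin A by apply/negP=> xA; apply: disjoint_notin dAB xA xB.
have dmA : [disjoint m & A].
  apply: contraNT xNA => /meetP[z zm zA].
  by rewrite -(parallel_class_disjoint (plane b) (F_class i b) mF AF zm zA).
have [_ _ parP _] := plane b.
have [k [_ uniq_k]] := parP x A (F_sub BF xB) (F_line AF) xNA.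
have mB : m = B.
  rewrite -(uniq_k m); last by split=> //; apply: F_line mF.
  by apply: uniq_k; split; rewrite 1?disjoint_sym //; apply: F_line BF.
rewrite mB in mF; case/eqP: ij.
exact: (color_eq i j B B x y (F_petal mF) (F_petal BF)).
Qed.

Lemma extended_linesP b l :
  reflect (l = e \/ exists i A, A \in F i b /\ l = v i |: A)
          (l \in extended_lines e v F b).
Proof.
rewrite !inE; apply: (iffP orP) => [[/eqP->|/bigcupP[i _ /imsetP[A AF ->]]] | ].
- by left.
- by right; exists i, A.
case=> [->|[i [A [AF ->]]]]; first by left.
by right; apply/bigcupP; exists i => //; apply: imset_f.
Qed.

Lemma extended_line_edge b l : l \in extended_lines e v F b -> l \in E.
Proof.
by case/extended_linesP=> [->//|[i [A [/F_petal/petalP[_ AE _] ->]]]].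
Qed.

(** The linearity of the hypergraph gives all uniqueness statements of the
    projective plane. *)
Lemma extended_line_eq b l m x y : l \in extended_lines e v F b ->
    m \in extended_lines e v F b -> x \in l -> y \in l -> x \in m -> y \in m ->
  x != y -> l = m.
Proof. by move=> /extended_line_edge lE /extended_line_edge mE; apply: (linear_edge_eq E_lin). Qed.

Lemma extended_line_of i b A : A \in F i b -> v i |: A \in extended_lines e v F b.
Proof. by move=> AF; apply/extended_linesP; right; exists i, A. Qed.

Lemma base_extended b : e \in extended_lines e v F b.
Proof. by apply/extended_linesP; left. Qed.

(** A point x of the packet is joined to v_i by the line of color i through x,
    and two base points by e. *)
Lemma extended_joining b :
  unique_joining_line (Omega b :|: e) (extended_lines e v F b).
Proof.
have suff_join x y : x != y -> (exists2 l, l \in extended_lines e v F b & x \in l /\ y \in l) ->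
    exists! l, [/\ l \in extended_lines e v F b, x \in l & y \in l].
  move=> xy [l lL [xl yl]]; exists l; split=> // m [mL xm ym].
  exact: (extended_line_eq lL mL xl yl xm ym xy).
have join_base x i : x \in Omega b ->
    exists2 l, l \in extended_lines e v F b & x \in l /\ v i \in l.
  rewrite -(F_cover i) => /bigcupP[A AF xA].
  by exists (v i |: A); [apply: extended_line_of | split; rewrite ?setU11 ?setU1r].
have base_pt x : x \in e -> exists i, x = v i by rewrite e_def => /imsetP[i _ ->]; exists i.
move=> x y /setUP[xO|xe] /setUP[yO|ye] xy; apply: suff_join => //.
- have [_ join _ _] := plane b; have [l [[lL xl yl] _]] := join x y xO yO xy.
  case/bigcupP: lL => i _ lF.
  by exists (v i |: l); [apply: extended_line_of | split; apply: setU1r].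
- by have [i ->] := base_pt y ye; apply: join_base.
- have [i ->] := base_pt x xe; have [l lL [yl vl]] := join_base y i yO.
  by exists l.
by exists e; first exact: base_extended.
Qed.

(** Lines of the same color i meet at v_i and lines of different colors already
    meet in the packet. *)
Lemma extended_meet b l m : l \in extended_lines e v F b ->
    m \in extended_lines e v F b -> l != m ->
  exists! x, x \in l /\ x \in m.
Proof.
move=> lL mL lm; suff [x xl xm] : exists2 x, x \in l & x \in m.
  exists x; split=> // y [yl ym]; apply: contraNeq lm => xy; apply/eqP.
  exact: (extended_line_eq lL mL xl yl xm ym xy).
case/extended_linesP: lL (lL) (mL) lm => [->|[i [A [AF ->]]]] _ /extended_linesP[->|[j [B [BF ->]]]] lm.
- by rewrite eqxx in lm.
- by exists (v j); rewrite ?setU11.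
- by exists (v i); rewrite ?setU11.
case: (altP (i =P j)) => [->|ij]; first by exists (v j); rewrite setU11.
by have /meetP[x xA xB] := packet_colors_meet AF BF ij; exists x; rewrite setU1r.
Qed.

(** Take two points x, y of a line of color k and two base points v_i, v_j of
    other colors: the line x y meets e at v_k, so it misses v_i and v_j, and
    every line other than x y and e has at most one point in each pair. *)
Lemma extended_quadrangle b : exists Q : {set V},
  [/\ Q \subset Omega b :|: e, #|Q| = 4
    & forall l, l \in extended_lines e v F b -> #|Q :&: l| <= 2].
Proof.
have [cardG _ _] := petal_system.
have dOe x : x \in Omega b -> x \in e -> False.
  exact: disjoint_notin (packet_base_disjoint b).
have /card_gt2P[i [j [k [_ [ij jk ki]]]]] : 2 < #|[set: 'I_q.+1]|.
  by rewrite cardsT card_ord ltnS (leq_trans t_ge2).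
have [A AF] : exists A, A \in F k b.
  have : 0 < #|cover (F k b)| by rewrite F_cover card_Omega expn_gt0; lia.
  by rewrite card_gt0 => /set0Pn[x /bigcupP[A AF _]]; exists A.
have /card_gt1P[x [y [xA yA xy]]] : 1 < #|A|.
  by rewrite (cardG k A (F_petal AF)) (leq_trans t_ge2).
have xO := F_sub AF xA; have yO := F_sub AF yA.
have vij : v i != v j by rewrite (inj_eq v_inj).
have xNv h : (x == v h) = false.
  by apply/eqP=> xv; apply: (dOe x); rewrite // xv v_in.
have yNv h : (y == v h) = false.
  by apply/eqP=> yv; apply: (dOe y); rewrite // yv v_in.
exists ([set x; y] :|: [set v i; v j]); split.
- by rewrite !subUset !sub1set !inE xO yO !v_in !orbT.
- rewrite cardsU !cards2 xy vij [_ :&: _](_ : _ = set0) ?cards0 //.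
  apply/setP=> z; rewrite !inE; apply/negP=> /andP[/orP[]/eqP->].
    by rewrite !xNv.
  by rewrite !yNv.
move=> l lL; case: (boolP ((x \in l) && (y \in l))) => [/andP[xl yl] | notxy].
  have defl : v k |: A = l.
    by apply: (extended_line_eq (extended_line_of AF) lL (x := x) (y := y)); rewrite ?setU1r.
  have vNl h : h != k -> v h \notin l.
    move=> hk; rewrite -defl !inE (inj_eq v_inj) (negPf hk) /=.
    by apply/negP=> vA; apply: (dOe (v h)) (v_in h); apply: F_sub AF vA.
  apply: leq_trans (_ : #|[set x; y]| <= 2); last by rewrite cards2 xy.
  apply: subset_leq_card; apply/subsetP=> z; rewrite !inE.
  case/andP=> [/orP[-> //|/orP[]/eqP->]] zl.
    by rewrite (negPf (vNl i _)) // eq_sym in zl.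
  by rewrite (negPf (vNl j _)) // in zl.
rewrite setIUl; apply: (leq_trans (leq_card_setU _ _)).
case: (altP (l =P e)) => [->|le].
  have -> : [set x; y] :&: e = set0.
    apply/setP=> z; rewrite !inE; apply/negP=> /andP[/orP[]/eqP-> ze].
      exact: dOe ze.
    exact: dOe ze.
  by rewrite cards0 (leq_trans (subset_leq_card (subsetIl _ _))) // cards2 vij.
apply: (@leq_add _ _ 1 1).
  apply/card_le1_eqP=> z w; rewrite !inE => /andP[zxy zl] /andP[wxy wl].
  move: notxy; case/orP: zxy zl => /eqP-> zl; case/orP: wxy wl => /eqP-> wl //;
    by rewrite zl wl.
apply/card_le1_eqP=> z w; rewrite !inE => /andP[zv zl] /andP[wv wl].
apply: contraNeq le => zw; apply/eqP.
have ze : z \in e by case/orP: zv => /eqP->.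
have we : w \in e by case/orP: wv => /eqP->.
exact: (extended_line_eq lL (base_extended b) wl zl we ze zw).
Qed.

Lemma extended_projective b :
  projective_plane q (Omega b :|: e) (extended_lines e v F b).
Proof.
split; [|exact: extended_joining|exact: extended_meet|exact: extended_quadrangle].
move=> l lL; split; last by apply: E_unif; apply: extended_line_edge lL.
case/extended_linesP: lL => [->|[i [A [AF ->]]]]; first exact: subsetUr.
rewrite subUset sub1set inE v_in orbT /=; apply/subsetP=> x xA.
by rewrite inE (F_sub AF xA).
Qed.

Lemma extended_share_base b c : b != c ->
  (Omega b :|: e) :&: (Omega c :|: e) = e /\
  extended_lines e v F b :&: extended_lines e v F c = [set e].
Proof.
move=> bc; have [[_ /(_ b c bc) dO] _ _ _ _] := packets; split.
  by rewrite -setUIl (disjoint_setI0 dO) set0U.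
apply/setP=> l; rewrite in_setI in_set1; apply/andP/eqP => [[] | ->]; last first.
  by split; apply: base_extended.
case/extended_linesP=> [-> //|[i [A [AF ->]]]] /extended_linesP[-> //|[j [B [BF eq_AB]]]].
have [cardG _ _] := petal_system.
have /card_gt1P[x [_ [xA _ _]]] : 1 < #|A|.
  by rewrite (cardG i A (F_petal AF)) (leq_trans t_ge2).
have : x \in v j |: B by rewrite -eq_AB setU1r.
case/setU1P=> [xv|xB]; last by case: (disjoint_notin dO (F_sub AF xA) (F_sub BF xB)).
by case: (disjoint_notin (packet_base_disjoint b) (F_sub AF xA)); rewrite xv.
Qed.

End Packets.

End PetalTrace.

Theorem theorem3p5 (t q : nat) (t_ge2 : 2 <= t) (t_le_q : t <= q)
    (V : finType) (E : {set {set V}})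
    (E_unif : uniform_hypergraph E q.+1) (E_lin : linear_hypergraph E)
    (E_free : crown_free E t.+1)
    (e : {set V}) (eE : e \in E)
    (v : 'I_q.+1 -> V) (v_inj : injective v) (e_def : e = [set v i | i : 'I_q.+1]) :
  [/\ delta E q.+1 (t * q + 1) e = 0%R <->
        (forall x, x \in e -> deg E x = t * q + 1),
      (forall x, x \in e -> deg E x = t * q + 1) <->
        (exists (Omega : 'I_t -> {set V})
                (F : 'I_q.+1 -> 'I_t -> {set {set V}}),
           affine_packets E e v Omega F)
    & forall (Omega : 'I_t -> {set V}) (F : 'I_q.+1 -> 'I_t -> {set {set V}}),
        affine_packets E e v Omega F ->
        (forall b, projective_plane q (Omega b :|: e) (extended_lines e v F b)) /\
        (forall b, e \in extended_lines e v F b) /\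
        (forall b c, b != c ->
           (Omega b :|: e) :&: (Omega c :|: e) = e /\
           extended_lines e v F b :&: extended_lines e v F c = [set e])].
Proof.
have degP := deg_full t eE e_def.
split.
- apply: iff_trans (iff_sym degP).
  exact: (delta_eq0 t_ge2 t_le_q E_unif E_lin eE v_inj e_def E_free).
- apply: (iff_trans degP); split.
    exact: (packets_of_full t_ge2 t_le_q E_unif E_lin eE v_inj e_def E_free).
  by case=> Omega [F packets] i; apply: (full_of_packets t_ge2 t_le_q packets).
move=> Omega F packets; split=> [b|].
  exact: (extended_projective t_ge2 t_le_q E_unif E_lin eE v_inj e_def packets).
split=> [b|b c bc]; first exact: base_extended.
exact: (extended_share_base t_ge2 t_le_q E_unif E_lin eE v_inj e_def packets bc).
Qed.
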